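(* Let $X=X(\mathbb T)$ be a Banach lattice satisfying Assumption A in which the set of all trigonometric polynomials is dense, let $r,s\in\mathbb N$ with $2r\ge s$, and let $(G_n)_{n\in\mathbb N}$ be linear sampling operators. Consider the conditions, with constants $K_1,K_2,K_3>0$ and required for all $n\in\mathbb N$: $(A_1)$ $\|G_nf\|_X\le K_1\|f\|_{X_n}$ for all $f\in X$; $(A_2)$ $K_2\|f\|_{X_n}\le\|G_nf\|_X$ for all $f\in X$; $(A_3)$ $\|T-G_nT\|_X\le K_3n^{-s}\|T^{(s)}\|_X$ for all $T\in\mathcal T_n$. For every bounded measurable function $f$ on $\mathbb T$ the following hold. (i) If $(A_1)$, $(A_2)$ and $(A_3)$ hold, then $\|f-G_nf\|_X\to0$ as $n\to\infty$ if and only if $\|(I-A_{\gamma/n})^rf\|_{X_n}\to0$ as $n\to\infty$. (ii) If $(A_1)$ and $(A_3)$ hold and $G_ng\in\mathcal T_n$ for all $g\in X$ and $n\in\mathbb N$, then $\|f-G_nf\|_X+\|f-G_nf\|_{X_n}\to0$ as $n\to\infty$ if and only if $\|(I-A_{\gamma/n})^rf\|_{X_n}\to0$ as $n\to\infty$.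
   Context: $\mathbb T$ is the unit circle identified with $[-\pi,\pi)$ (functions on $\mathbb T$ are $2\pi$-periodic), with normalized Lebesgue measure $\mu$. A Banach lattice $X=X(\mathbb T)$ is a Banach space of measurable functions on $\mathbb T$ such that: 1) if $f$ is measurable, $g\in X$ and $|f|\le|g|$, then $f\in X$ and $\|f\|_X\le\|g\|_X$; 2) if $f_n\in X$, $\sup_n\|f_n\|_X<\infty$ and $0\le f_n\uparrow f$, then $f\in X$ and $\|f_n\|_X\to\|f\|_X$; 3) for every measurable $E$ with $\mu(E)<\infty$, $\chi_E\in X$ and there is $c_E>0$ with $\int_E|f|\,d\mu\le c_E\|f\|_X$. Functions in $X$ are regarded as finite-valued and defined at every point, not as equivalence classes. Steklov averages: $A_hf(x)=\frac1h\int_{x-h/2}^{x+h/2}f(t)\,dt$ for $h>0$; $I$ is the identity. Assumption A: $A_hf\in X$ for all $f\in X$, $h>0$, and $\sup_{h>0,\,\|f\|_X\le1}\|A_hf\|_X<\infty$. $\mathcal T_n$ is the set of trigonometric polynomials of degree at most $n$. $(\Phi_n)$ are linear subspaces of $X$ with $\Phi_m\subset\Phi_n$ for $m\le n$, $\Phi_0=\{0\}$, satisfying $\|\varphi^{(q)}\|_X\le(Bn)^q\|\varphi\|_X$ for all $q\in\mathbb N$, $\varphi\in\Phi_n$, with a constant $B=B_X>0$. (If $X$ is translation-invariant, spline spaces of smoothness $s$ are also admitted, with this inequality required only for $q\le s$.) Sampling operators: $G_nf(x)=\sum_{k=1}^{m_n}f(x_{k,n})\varphi_{k,n}(x)$,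 $n\in\mathbb N$, where $\varphi_{k,n}\in\Phi_n$ are $2\pi$-periodic and $x_k=x_{k,n}\in\mathbb T$ are nodes such that for some fixed $\gamma,\gamma'>0$, $\frac{\gamma}{n}\le x_{k+1,n}-x_{k,n}\le\frac{\gamma'}{n}$ for $k=1,\dots,m_n$, with $x_{m_n+1,n}=2\pi+x_{1,n}$. The constant $\gamma$ in the claim is this one. The discrete semi-norm is $\|f\|_{X_n}=\big\|\sum_{k=1}^{m_n}|f(x_k)|\chi_{[x_k,x_{k+1})}\big\|_X$. *)

(* Defs.v *)
From HB Require Import structures.
From mathcomp Require Import all_boot all_order all_algebra.
From mathcomp Require Import all_classical all_reals all_analysis.
Set Implicit Arguments.
Unset Strict Implicit.
Unset Printing Implicit Defensive.
Import Order.TTheory GRing.Theory Num.Theory.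
Import numFieldNormedType.Exports.

Local Open Scope classical_set_scope.
Local Open Scope ring_scope.

(* Measurability, "almost everywhere" and integrals all refer to the completed
   Lebesgue measure, because the pointwise values of functions matter here and
   Borel measurability would be too restrictive.  lebR R is R equipped with the
   Lebesgue sigma-algebra. *)
Definition lebR (R : realType) :=
  caratheodory_type ((wlength (idfun : R -> R))^*)%mu.

Notation leb := completed_lebesgue_measure.

(* A function on the circle is a 2pi-periodic function on the line; an a.e.
   statement about such functions may be read on the whole line. *)
Definition torus_fun (R : realType) (f : R -> R) : Prop :=
  (forall x, f (x + 2 * pi) = f x) /\
  measurable_fun (setT : set (lebR R)) (f : lebR R -> R).

Definition torus (R : realType) : set R := `[- pi, pi[%classic.
Arguments torus R : clear implicits.

Definition periodize (R : realType) (E : set R) : set R :=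
  [set x | exists j : int, E (x + j%:~R * (2 * pi))].

(* The integral over E of g with respect to dx / (2pi). *)
Definition torus_integral (R : realType) (E : set R) (g : R -> \bar R) : \bar R :=
  (((2 * pi)^-1)%:E * \int[leb]_(x in (E : set (lebR R))) g x)%E.

(* Elements are everywhere-defined real functions, with no quotient by a.e.
   equality, so bl_norm vanishes exactly on the functions that are a.e. 0;
   its values outside of the carrier are irrelevant. *)
Record banach_lattice (R : realType) := BanachLattice {
  bl_carrier :> (R -> R) -> Prop;
  bl_norm : (R -> R) -> R;
  bl_torus : forall f, bl_carrier f -> torus_fun f;
  bl_0 : bl_carrier (fun=> 0);
  bl_add : forall f g,
    bl_carrier f -> bl_carrier g -> bl_carrier (fun x => f x + g x);
  bl_scale : forall (a : R) f,
    bl_carrier f -> bl_carrier (fun x => a * f x);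
  bl_norm_ge0 : forall f, bl_carrier f -> 0 <= bl_norm f;
  bl_norm_eq0 : forall f, bl_carrier f ->
    bl_norm f = 0 <-> {ae leb, forall x : lebR R, f x = 0};
  bl_normD : forall f g, bl_carrier f -> bl_carrier g ->
    bl_norm (fun x => f x + g x) <= bl_norm f + bl_norm g;
  bl_normZ : forall (a : R) f, bl_carrier f ->
    bl_norm (fun x => a * f x) = `|a| * bl_norm f;
  bl_complete : forall u : nat -> R -> R, (forall n, bl_carrier (u n)) ->
    (forall e : R, 0 < e -> exists n0 : nat, forall i j : nat,
       (n0 <= i)%N -> (n0 <= j)%N -> bl_norm (fun x => u i x - u j x) < e) ->
    exists2 f, bl_carrier f &
      (fun n => bl_norm (fun x => u n x - f x)) @ \oo --> 0;
  bl_ideal : forall f g, torus_fun f -> bl_carrier g ->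
    {ae leb, forall x : lebR R, `|f x| <= `|g x|} ->
    bl_carrier f /\ bl_norm f <= bl_norm g;
  bl_fatou : forall (u : nat -> R -> R) (f : R -> R),
    (forall n, bl_carrier (u n)) ->
    (exists M : R, forall n, bl_norm (u n) <= M) ->
    torus_fun f ->
    {ae leb, forall x : lebR R,
       (forall n, 0 <= u n x <= u n.+1 x) /\ (u n x @[n --> \oo] --> f x)} ->
    bl_carrier f /\ (bl_norm (u n) @[n --> \oo] --> bl_norm f);
  bl_indic : forall E : set R, measurable (E : set (lebR R)) ->
    E `<=` torus R ->
    bl_carrier (\1_(periodize E)) /\
    exists2 c : R, 0 < c & forall f, bl_carrier f ->
      (torus_integral E (fun x => `|f x|%:E) <= (c * bl_norm f)%:E)%E
}.

Definition steklov (R : realType) (h : R) (f : R -> R) : R -> R := fun x =>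
  h^-1 * \int[leb]_(t in (`[x - h / 2, x + h / 2]%classic : set (lebR R))) f t.

Definition steklov_diff (R : realType) (r : nat) (h : R) (f : R -> R) : R -> R :=
  iter r (fun g x => g x - steklov h g x) f.

Definition assumptionA (R : realType) (X : banach_lattice R) : Prop :=
  (forall (f : R -> R) (h : R), X f -> 0 < h -> X (steklov h f)) /\
  (exists C : R, forall (f : R -> R) (h : R), X f -> 0 < h ->
     bl_norm X f <= 1 -> bl_norm X (steklov h f) <= C).

Definition trig_poly (R : realType) (n : nat) (T : R -> R) : Prop :=
  exists a b : nat -> R, forall x,
    T x = \sum_(k < n.+1) (a k * cos (k%:R * x) + b k * sin (k%:R * x)).

Definition trig_dense (R : realType) (X : banach_lattice R) : Prop :=
  forall (f : R -> R) (e : R), X f -> 0 < e ->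
    exists n T, trig_poly n T /\ bl_norm X (fun x => f x - T x) < e.

Definition bernstein (R : realType) (X : banach_lattice R)
    (Phi : nat -> set (R -> R)) (Q : set nat) : Prop :=
  exists2 B : R, 0 < B & forall n q (g : R -> R), Phi n g -> Q q ->
    X (derive1n q g) /\
    bl_norm X (derive1n q g) <= (B * n%:R) ^+ q * bl_norm X g.

Definition translation_invariant (R : realType) (X : banach_lattice R) : Prop :=
  forall (f : R -> R) (t : R), X f ->
    X (fun x => f (x + t)) /\ bl_norm X (fun x => f (x + t)) = bl_norm X f.

(* Periodic splines of class C^(s-1), of arbitrary degree and with a finite set
   F of knots per period: polynomial on each knot-free interval.  The s-th
   derivative exists off the knots; the values that derive1n takes at the knots
   form a null set and do not matter. *)
Definition is_spline (R : realType) (s : nat) (g : R -> R) : Prop :=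
  [/\ forall q x, (q.+1 < s)%N -> derivable (derive1n q g) x 1,
      forall q, (q < s)%N -> continuous (derive1n q g) &
      exists F : seq R, forall a b : R, - pi <= a -> a < b -> b <= pi ->
        (forall y, y \in F -> ~ (a < y < b)) ->
        exists p : {poly R}, forall x, a < x < b -> g x = p.[x]].

Definition approx_spaces (R : realType) (X : banach_lattice R)
    (Phi : nat -> set (R -> R)) : Prop :=
  [/\ forall n g, Phi n g -> X g,
      forall n (a : R) g h, Phi n g -> Phi n h ->
        Phi n (fun x => a * g x + h x),
      forall i j, (i <= j)%N -> Phi i `<=` Phi j,
      Phi 0%N = [set (fun=> 0)] &
      ((forall n g q x, Phi n g -> derivable (derive1n q g) x 1) /\
       bernstein X Phi setT)
      \/
      (translation_invariant X /\
       exists2 s0 : nat, (0 < s0)%N &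
         (forall n g, Phi n g -> is_spline s0 g) /\
         bernstein X Phi [set q | (q <= s0)%N])].

(* The nodes x_1, ..., x_m of the n-th operator are x 0, ..., x m.-1, and the
   wrap-around node x_(m+1) is x m; the wrap-around equation forces 0 < m. *)
Definition nodes_ok (R : realType) (gamma gamma' : R) (n m : nat)
    (x : nat -> R) : Prop :=
  [/\ forall k, (k < m)%N -> torus R (x k),
      x m = 2 * pi + x 0%N &
      forall k, (k < m)%N ->
        gamma / n%:R <= x k.+1 - x k <= gamma' / n%:R].

Definition sampling_op (R : realType) (m : nat) (x : nat -> R)
    (phi : nat -> R -> R) (f : R -> R) : R -> R :=
  fun t => \sum_(k < m) f (x k) * phi k t.

(* The last cell [x_m, x_1 + 2pi) may leave [-pi, pi), hence periodize. *)
Definition discrete_norm (R : realType) (X : banach_lattice R) (m : nat)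
    (x : nat -> R) (f : R -> R) : R :=
  bl_norm X (fun t =>
    \sum_(k < m) `|f (x k)| * \1_(periodize `[x k, x k.+1[%classic) t).

Definition condA1 (R : realType) (X : banach_lattice R) (m : nat -> nat)
    (x : nat -> nat -> R) (G : nat -> (R -> R) -> R -> R) : Prop :=
  exists2 K : R, 0 < K & forall n f, (0 < n)%N -> X f ->
    bl_norm X (G n f) <= K * discrete_norm X (m n) (x n) f.

Definition condA2 (R : realType) (X : banach_lattice R) (m : nat -> nat)
    (x : nat -> nat -> R) (G : nat -> (R -> R) -> R -> R) : Prop :=
  exists2 K : R, 0 < K & forall n f, (0 < n)%N -> X f ->
    K * discrete_norm X (m n) (x n) f <= bl_norm X (G n f).

Definition condA3 (R : realType) (X : banach_lattice R) (s : nat)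
    (G : nat -> (R -> R) -> R -> R) : Prop :=
  exists2 K : R, 0 < K & forall n T, (0 < n)%N -> trig_poly n T ->
    bl_norm X (fun t => T t - G n T t) <=
      K * n%:R ^- s * bl_norm X (derive1n s T).

(* Main.v *)
Require Import Defs.
From HB Require Import structures.
From mathcomp Require Import all_boot all_order all_algebra.
From mathcomp Require Import all_classical all_reals all_analysis.
From mathcomp Require Import measurable_realfun lra.
Set Implicit Arguments.
Unset Strict Implicit.
Unset Printing Implicit Defensive.
Import Order.TTheory GRing.Theory Num.Theory.
Import numFieldNormedType.Exports.

Local Open Scope classical_set_scope.
Local Open Scope ring_scope.

(** Write [h = gamma / n] and [A = A_h].  The boundedness of the Steklov means
    makes every discrepancy between the two sides of the equivalences harmless
    up to the error of approximating [f] by one fixed trigonometric polynomial.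

    A Steklov mean can be compared with the discrete norm: a point of the cell
    of [x_k] lies within [gamma' / n] of [x_k], so that [A_h |g| (x_k)] is at
    most [H / h] times a Steklov mean of [|g|] of length
    [H = (2 gamma' + gamma) / n] at that point, and [H / h] does not depend on
    [n].  Hence the discrete norm of [A g] is at most a constant times the norm
    of [g] ([discrete_norm_steklov]).  As [(I - A)^r g = g + A v] with [v]
    controlled by [g] ([steklov_diff_decomp]), the discrete norms of [g] and of
    [(I - A)^r g] differ by at most a constant times the norm of [g]
    ([discrete_norm_steklov_diff]).

    Given a small [e], choose by density a trigonometric polynomial [T] with
    [|| f - T || < e], and let [g = f - T].  For this fixed [T], the function
    [(I - A)^r T] tends to [0] uniformly, and [T - G_n T] tends to [0] in norm
    by [condA3].  So, up to [O(e) + o(1)], the discrete norm of [(I - A)^r f] is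
    that of [g], and the norm of [f - G_n f] is that of [G_n g].  The conditions
    [condA1] and [condA2] say that these two quantities bound one another.

    When the [G_n g] are trigonometric polynomials, one splits [f - G_n f] into
    [g - G_n g] and [T - G_n T] in the discrete norm, where the Bernstein
    inequality of the approximation spaces plays the part of [condA2].  By the
    fundamental theorem of calculus [|P - A P| <= h A |P'|], whence the discrete
    norm of [P] is at most a constant times its norm, for [P] in [Phi_n]
    ([approx_spaces_discrete_norm]).  This applies to [G_n g], not to
    [T - G_n T], because [T] need not belong to [Phi_n].  For the latter
    function, compare [G_n T] with [G_k T] for a fixed large [k]: the difference
    is in [Phi_n] and small in norm, while [T - G_k T] is one trigonometric
    polynomial, so that applying [I - A] makes it tend to [0] uniformly
    ([trig_approx_discrete_cvg]). *)

(** * Steklov means of bounded measurable functions *)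

Section Integration.
Context {R : realType}.
Implicit Types (f g : R -> R) (a b h x : R) (A : set R).

Lemma borel_lebR A : measurable A -> measurable (A : set (lebR R)).
Proof. by move=> mA; exact: sub_caratheodory. Qed.

Lemma borel_fun_lebR f :
  measurable_fun setT f -> measurable_fun setT (f : lebR R -> R).
Proof.
move=> mf _ Y mY; rewrite setTI; apply: borel_lebR.
by rewrite -[_ @^-1` _]setTI; exact: mf.
Qed.

Lemma continuous_lebR f :
  continuous f -> measurable_fun setT (f : lebR R -> R).
Proof.
by move=> cf; apply: borel_fun_lebR; exact: continuous_measurable_fun.
Qed.

Lemma measurable_itv_lebR (i : interval R) :
  measurable ([set` i] : set (lebR R)).
Proof. by apply: borel_lebR; exact: measurable_itv. Qed.
#[local] Hint Extern 0 (measurable [set` _]) =>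
  solve [apply: measurable_itv_lebR] : core.

Lemma leb_itvcc a b : a <= b ->
  leb (`[a, b]%classic : set (lebR R)) = (b - a)%:E.
Proof.
move=> ab; rewrite (_ : leb _ = lebesgue_measure `[a, b]%classic)//.
rewrite lebesgue_measure_itv/= lte_fin; case: ltP => // ba.
by rewrite (_ : b - a = 0)//; apply/eqP; rewrite subr_eq0 eq_le ba ab.
Qed.

Definition bmeasurable f :=
  measurable_fun setT (f : lebR R -> R) /\ exists M, forall t, `|f t| <= M.

Lemma bmeasurable_integrable f a b : bmeasurable f ->
  leb.-integrable (`[a, b]%classic : set (lebR R)) (EFin \o f).
Proof.
move=> [mf [M fM]]; apply: measurable_bounded_integrable => //.
- have [ab|ba] := leP a b.
    by apply: le_lt_trans (ltry (b - a)); rewrite -(leb_itvcc ab).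
  by rewrite set_itv_ge ?measure0// bnd_simp -ltNge.
- exact: measurable_funTS.
- exists M; split; first exact: num_real.
  by move=> y My t _; apply: le_trans (fM t) (ltW My).
Qed.

Lemma bmeasurableD f g : bmeasurable f -> bmeasurable g ->
  bmeasurable (fun x => f x + g x).
Proof.
move=> [mf [M fM]] [mg [N gN]]; split; first exact: measurable_funD.
by exists (M + N) => t; rewrite (le_trans (ler_normD _ _))// lerD.
Qed.

Lemma bmeasurableZ (c : R) f : bmeasurable f -> bmeasurable (fun x => c * f x).
Proof.
move=> [mf [M fM]]; split; first exact: measurable_funM.
by exists (`|c| * M) => t; rewrite normrM ler_wpM2l.
Qed.

Lemma bmeasurableB f g : bmeasurable f -> bmeasurable g ->
  bmeasurable (fun x => f x - g x).
Proof.
move=> bf bg; have := bmeasurableD bf (bmeasurableZ (-1) bg).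
by under eq_fun do rewrite mulN1r.
Qed.

Lemma bmeasurable_norm f : bmeasurable f -> bmeasurable (fun x => `|f x|).
Proof.
move=> [mf [M fM]]; split; first exact: measurableT_comp.
by exists M => t; rewrite normr_id.
Qed.

Lemma bmeasurable_cst (c : R) : bmeasurable (fun=> c).
Proof. by split; [exact: measurable_cst|exists `|c|]. Qed.

Lemma steklovZ h (c : R) f x : bmeasurable f ->
  steklov h (fun t => c * f t) x = c * steklov h f x.
Proof.
move=> bf; rewrite /steklov mulrCA; congr (_ * _).
by apply: RintegralZl => //; exact: bmeasurable_integrable.
Qed.

Lemma steklovB h f g x : bmeasurable f -> bmeasurable g ->
  steklov h (fun t => f t - g t) x = steklov h f x - steklov h g x.
Proof.
move=> bf bg; rewrite /steklov -mulrBr; congr (_ * _).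
by apply: RintegralB => //; exact: bmeasurable_integrable.
Qed.

Lemma steklov_cst h (c : R) x : 0 < h -> steklov h (fun=> c) x = c.
Proof.
move=> h0; rewrite /steklov Rintegral_cst// [X in c * X](_ : _ = h).
  by rewrite mulrCA mulVf ?mulr1// gt_eqF.
rewrite -[RHS]/(fine h%:E); congr fine.
transitivity (x + h / 2 - (x - h / 2))%:E; last by congr EFin; lra.
by apply: leb_itvcc; lra.
Qed.

Lemma steklov_le h f g x : 0 < h -> bmeasurable f -> bmeasurable g ->
  (forall t, x - h / 2 <= t <= x + h / 2 -> f t <= g t) ->
  steklov h f x <= steklov h g x.
Proof.
move=> h0 bf bg fg; rewrite /steklov ler_wpM2l ?invr_ge0 ?(ltW h0)//.
by apply: le_Rintegral => //; exact: bmeasurable_integrable.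
Qed.

Lemma steklov_norm h f x : 0 < h -> bmeasurable f ->
  `|steklov h f x| <= steklov h (fun t => `|f t|) x.
Proof.
move=> h0 bf; rewrite /steklov normrM gtr0_norm ?invr_gt0//.
rewrite ler_wpM2l ?invr_ge0 ?(ltW h0)// le_normr_Rintegral//.
exact: bmeasurable_integrable.
Qed.

Lemma steklov_bound h f x (M : R) : 0 < h -> bmeasurable f ->
  (forall t, `|f t| <= M) -> `|steklov h f x| <= M.
Proof.
move=> h0 bf fM; apply: le_trans (steklov_norm _ h0 bf) _.
apply: (@le_trans _ _ (steklov h (fun=> M) x)); last by rewrite steklov_cst.
apply: (steklov_le h0).
- exact: bmeasurable_norm.
- exact: bmeasurable_cst.
- by move=> t _; exact: fM.
Qed.

Lemma Rintegral_itv_widen f a b c d : c <= a -> b <= d ->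
  bmeasurable f -> (forall t, 0 <= f t) ->
  \int[leb]_(t in (`[a, b]%classic : set (lebR R))) f t <=
  \int[leb]_(t in (`[c, d]%classic : set (lebR R))) f t.
Proof.
move=> ca bd bf f0; apply: fine_le.
- apply: integrable_fin_num; first exact: measurable_itv_lebR.
  exact: bmeasurable_integrable.
- apply: integrable_fin_num; first exact: measurable_itv_lebR.
  exact: bmeasurable_integrable.
- apply: ge0_subset_integral.
  + exact: measurable_itv_lebR.
  + exact: measurable_itv_lebR.
  + by apply: measurable_funTS; apply/measurable_EFinP; exact: (bf.1).
  + by move=> t _; rewrite lee_fin.
  + move=> t /=; rewrite !in_itv/= => /andP[at_ tb].
    by rewrite (le_trans ca at_) (le_trans tb bd).
Qed.

(** Enlarging the window costs only the ratio of the lengths, by positivity. *)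
Lemma steklov_widen (h H : R) f x y : 0 < h ->
  y - H / 2 <= x - h / 2 -> x + h / 2 <= y + H / 2 ->
  bmeasurable f -> (forall t, 0 <= f t) ->
  steklov h f x <= H / h * steklov H f y.
Proof.
move=> h0 l r bf f0; have H0 : 0 < H by lra.
rewrite /steklov mulrA (mulrC (H / h)) mulrA mulVf ?gt_eqF// mul1r.
by rewrite ler_wpM2l ?invr_ge0 ?(ltW h0)// Rintegral_itv_widen.
Qed.

(** The mean fixes the constant [f x], so it moves [f x] by at most the
    oscillation of [f] on the window. *)
Lemma steklov_osc h f x (e : R) : 0 < h -> bmeasurable f ->
  (forall t, x - h / 2 <= t <= x + h / 2 -> `|f t - f x| <= e) ->
  `|f x - steklov h f x| <= e.
Proof.
move=> h0 bf fe; rewrite distrC.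
have bc := bmeasurable_cst (f x).
have -> : steklov h f x - f x = steklov h (fun t => f t - f x) x.
  by rewrite (steklovB _ _ bf bc) steklov_cst.
have bd : bmeasurable (fun t => f t - f x) := bmeasurableB bf bc.
apply: le_trans (steklov_norm _ h0 bd) _.
apply: (@le_trans _ _ (steklov h (fun=> e) x)); last by rewrite steklov_cst.
apply: (steklov_le h0).
- exact: bmeasurable_norm.
- exact: bmeasurable_cst.
- exact: fe.
Qed.

(** The fundamental theorem of calculus concerns the Borel-Lebesgue measure,
    which is the image of its completion under the identity. *)
Lemma Rintegral_leb_ge0 f a b : continuous f -> (forall t, 0 <= f t) ->
  \int[leb]_(t in (`[a, b]%classic : set (lebR R))) f t =
  \int[lebesgue_measure]_(t in `[a, b]) f t.
Proof.
move=> cf f0; congr fine.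
pose id' (t : lebR R) : measurableTypeR R := t.
have mid : measurable_fun setT id'.
  by move=> _ Y mY; rewrite setTI; exact: borel_lebR.
have := @ge0_integral_pushforward _ _ (lebR R) (measurableTypeR R) R id' mid leb
  `[a, b]%classic (EFin \o f).
move=> /(_ (measurable_itv _)) <-.
- exact: eq_measure_integral.
- apply: measurable_funTS; apply/measurable_EFinP.
  exact: continuous_measurable_fun.
- by move=> t _; rewrite lee_fin.
Qed.

Lemma le_Rintegral_norm_derive1 f a b : a <= b ->
  (forall t, derivable f t 1) -> continuous (derive1 f) ->
  `|f b - f a| <=
    \int[leb]_(t in (`[a, b]%classic : set (lebR R))) `|derive1 f t|.
Proof.
rewrite le_eqVlt => /predU1P[->|ab] df cf.
  by rewrite subrr normr0 Rintegral_ge0.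
have cdf : continuous (fun t => `|derive1 f t|).
  by move=> t; apply: cvg_norm; exact: cf.
rewrite Rintegral_leb_ge0//.
have cF : continuous f.
  by move=> t; apply: differentiable_continuous; exact/derivable1_diffP.
have E : \int[lebesgue_measure]_(t in `[a, b]) derive1 f t = f b - f a.
  have LR : derivable_oo_LRcontinuous f a b.
    split; first by move=> t _; exact: df.
    - by apply: cvg_at_right_filter; exact: cF.
    - by apply: cvg_at_left_filter; exact: cF.
  by rewrite /Rintegral
    (continuous_FTC2 ab (continuous_subspaceT cf) LR (fun _ _ => erefl)).
rewrite -E; apply: le_normr_Rintegral => //.
apply: continuous_compact_integrable; first exact: segment_compact.
exact: continuous_subspaceT.
Qed.

(** On the window, [f] varies by at most the integral of [|f'|] over it, that
    is, [h] times a Steklov mean.  Keeping the mean of [|f'|], rather than its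
    supremum, is what lets the norm of [f'] in the lattice bound this difference
    later on. *)
Lemma steklov_derive1_le f h x : 0 < h -> bmeasurable f ->
  (forall t, derivable f t 1) -> continuous (derive1 f) ->
  bmeasurable (derive1 f) ->
  `|f x - steklov h f x| <= h * steklov h (fun t => `|derive1 f t|) x.
Proof.
move=> h0 bf df cf bdf.
set I := h * _; rewrite distrC.
have IE : I = \int[leb]_(t in (`[x - h / 2, x + h / 2]%classic : set (lebR R)))
    `|derive1 f t|.
  by rewrite /I /steklov mulrA mulfV ?mul1r// gt_eqF.
have fI t : x - h / 2 <= t <= x + h / 2 -> `|f t - f x| <= I.
  move=> /andP[xt tx].
  have sub a b : x - h / 2 <= a -> b <= x + h / 2 ->
      \int[leb]_(t in (`[a, b]%classic : set (lebR R))) `|derive1 f t| <= I.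
    move=> xa bx; rewrite IE.
    apply: (Rintegral_itv_widen xa bx (bmeasurable_norm bdf)) => y.
    exact: normr_ge0.
  have [tlx|xlt] := leP t x.
    rewrite distrC; apply: le_trans (le_Rintegral_norm_derive1 tlx df cf) _.
    by apply: sub; lra.
  apply: le_trans (le_Rintegral_norm_derive1 (ltW xlt) df cf) _.
  by apply: sub; lra.
by rewrite distrC; exact: steklov_osc.
Qed.

End Integration.

(** * Bounded periodic functions and the cells of the nodes *)

Section BoundedPeriodic.
Context {R : realType}.
Implicit Types (f g : R -> R).

(** Every function to which Steklov means are applied is of this kind.  Such a
    function is integrable on every bounded interval and belongs to every
    lattice, so that neither has to be carried along as a hypothesis. *)
Definition btorus f := torus_fun f /\ exists M, forall t, `|f t| <= M.

Lemma btorus_bmeasurable f : btorus f -> bmeasurable f.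
Proof. by move=> [[_ mf] bf]. Qed.

Lemma btorusD f g : btorus f -> btorus g -> btorus (fun x => f x + g x).
Proof.
move=> bf bg.
have [mD bD] := bmeasurableD (btorus_bmeasurable bf) (btorus_bmeasurable bg).
by split=> //; split=> // x; rewrite bf.1.1 bg.1.1.
Qed.

Lemma btorusZ (c : R) f : btorus f -> btorus (fun x => c * f x).
Proof.
move=> bf; have [mD bD] := bmeasurableZ c (btorus_bmeasurable bf).
by split=> //; split=> // x; rewrite bf.1.1.
Qed.

Lemma btorusB f g : btorus f -> btorus g -> btorus (fun x => f x - g x).
Proof.
move=> bf bg; have := btorusD bf (btorusZ (-1) bg).
by under eq_fun do rewrite mulN1r.
Qed.

Lemma btorus_norm f : btorus f -> btorus (fun x => `|f x|).
Proof.
move=> bf; have [mD bD] := bmeasurable_norm (btorus_bmeasurable bf).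
by split=> //; split=> // x; rewrite bf.1.1.
Qed.

Lemma btorus_cst (c : R) : btorus (fun=> c).
Proof. by have [mc bc] := bmeasurable_cst c; split. Qed.

Lemma periodic_int f : (forall x, f (x + 2 * pi) = f x) ->
  forall (j : int) x, f (x + j%:~R * (2 * pi)) = f x.
Proof.
move=> pf; have pn (k : nat) x : f (x + k%:R * (2 * pi)) = f x.
  elim: k => [|k IH]; first by rewrite mul0r addr0.
  by rewrite -natr1 mulrDl mul1r addrA pf.
case=> k x; first exact: pn.
by rewrite -(pn k.+1 (x + _)) NegzE mulrNz mulNr subrK.
Qed.

Lemma measurable_periodize (a b : R) :
  measurable (periodize `[a, b[%classic : set (lebR R)).
Proof.
rewrite (_ : periodize _ = \bigcup_(j : int)
    `[a - j%:~R * (2 * pi), b - j%:~R * (2 * pi)[%classic).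
  apply: countable_bigcupT_measurable; first exact: countableP.
  by move=> j; exact: measurable_itv_lebR.
rewrite predeqE => t; split=> [[j]|[j _]]; rewrite /= in_itv/= => h.
  by exists j => //=; rewrite in_itv/= lerBlDr ltrBrDr.
by exists j; rewrite /= in_itv/= -lerBlDr -ltrBrDr.
Qed.

Lemma periodize_periodic (E : set R) x :
  periodize E (x + 2 * pi) <-> periodize E x.
Proof.
split=> -[j Ej].
  exists (j + 1); rewrite intrD mulrDl mul1r.
  by rewrite (addrC (_ * _)) addrA.
exists (j - 1); rewrite intrB mulrBl mul1r.
by rewrite addrACA subrr addr0.
Qed.

Lemma periodize_torus : periodize (torus R) = setT.
Proof.
rewrite predeqE => x; split=> // _.
have p0 := @pi_gt0 R; set k := Num.floor ((x + pi) / (2 * pi)).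
exists (- k); rewrite /torus /= in_itv/=.
have /andP[] := floor_itv ((x + pi) / (2 * pi)); rewrite -/k.
rewrite ler_pdivlMr ?ltr_pdivrMr ?mulr_gt0// intrD mulrDl mul1r mulrNz mulNr.
by move=> *; apply/andP; split; lra.
Qed.

Definition cell_step (m : nat) (x c : nat -> R) : R -> R := fun t =>
  \sum_(k < m) c k * \1_(periodize `[x k, x k.+1[%classic) t.

Lemma btorus_cell_step m x c : btorus (cell_step m x c).
Proof.
rewrite /cell_step; elim: m => [|m IH].
  by under eq_fun do rewrite big_ord0; exact: btorus_cst.
under eq_fun do rewrite big_ord_recr/=.
apply: (btorusD IH); apply: btorusZ; split; last first.
  by exists 1 => t; rewrite indicE; case: (_ \in _); rewrite ?normr1 ?normr0.
split; last by apply: measurable_indic; exact: measurable_periodize.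
move=> t; rewrite !indicE; congr (_ %:R); congr (nat_of_bool _).
by apply/idP/idP; rewrite !inE => tE; apply/periodize_periodic.
Qed.

End BoundedPeriodic.

Section Nodes.
Context {R : realType}.
Variables (gamma gamma' : R) (n m : nat) (x : nat -> R).
Hypotheses (gamma0 : 0 < gamma)
  (nodes : nodes_ok gamma gamma' n m x).

Lemma nodes_mono i j : (i <= j)%N -> (j <= m)%N -> x i <= x j.
Proof.
have [_ _ gap] := nodes; elim: j => [|j IH]; first by rewrite leqn0 => /eqP->.
rewrite leq_eqVlt => /predU1P[-> //|ij jm].
apply: le_trans (IH ij (ltnW jm)) _.
have /andP[gap_j _] := gap _ jm.
by rewrite -subr_ge0 (le_trans _ gap_j)// divr_ge0// ltW.
Qed.

(** Translates by distinct multiples of [2 pi] are too far apart for both to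
    fall into [[x_0, x_0 + 2 pi)], and the cells partition that interval. *)
Lemma cells_disjoint k l t : (k < m)%N -> (l < m)%N ->
  periodize `[x k, x k.+1[%classic t -> periodize `[x l, x l.+1[%classic t ->
  k = l.
Proof.
have lt_incr (k' l' : nat) s : (k' < l')%N -> (l' < m)%N ->
    s < x k'.+1 -> x l' <= s -> False.
  move=> kl lm; have := nodes_mono kl (ltnW lm).
  by move=> *; lra.
have [_ xm _] := nodes.
move=> km lm [i]; rewrite /= in_itv/= => /andP[ki ik] [j].
rewrite /= in_itv/= => /andP[lj jl].
have B1 := nodes_mono (leq0n k) (ltnW km).
have B2 := nodes_mono (leq0n l) (ltnW lm).
have B3 := nodes_mono km (leqnn m).
have B4 := nodes_mono lm (leqnn m).
have p0 := @pi_gt0 R.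
have far (a b : int) : a < b ->
    a%:~R * (2 * pi) + 2 * pi <= b%:~R * (2 * pi) :> R.
  move=> ab; rewrite -{2}[2 * pi]mul1r -mulrDl ler_pM2r ?mulr_gt0//.
  by rewrite -[1]/(1%:~R) -intrD ler_int -ltzD1 ltrD2r.
have ij : i = j.
  move: xm ki ik lj jl p0 (far i j) (far j i); set p : R := 2 * pi.
  move: (i%:~R * p) (j%:~R * p) => u v xm ki ik lj jl _ far1 far2.
  case: (ltgtP i j) => [/far1|/far2|//] far_apart; exfalso; lra.
subst j; case: (ltngtP k l) => // kl.
  by case: (lt_incr _ _ _ kl lm ik lj).
by case: (lt_incr _ _ _ kl km jl ki).
Qed.

(** At most one term of the sum survives at a given point, so a bound on the
    value of each cell bounds the step function, however many cells there are. *)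
Lemma cell_step_le (c : nat -> R) t (M : R) : 0 <= M ->
  (forall k (j : int), (k < m)%N -> x k <= t + j%:~R * (2 * pi) < x k.+1 ->
     c k <= M) ->
  cell_step m x c t <= M.
Proof.
move=> M0 cM; rewrite /cell_step.
have [[k tk]|none] :=
    pselect (exists k : 'I_m, periodize `[x k, x k.+1[%classic t).
  rewrite (bigD1 k)//= big1 ?addr0; last first.
    move=> l lk; rewrite indicE memNset ?mulr0// => tl.
    by move/eqP: lk; apply; apply: val_inj; exact: cells_disjoint tl tk.
  rewrite indicE mem_set// mulr1; have [j] := tk; rewrite /= in_itv/=.
  exact: cM.
rewrite big1// => k _; rewrite indicE memNset ?mulr0// => tk.
by apply: none; exists k.
Qed.

End Nodes.

(** * Norm and discrete norm on bounded periodic functions *)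

Section Lattice.
Context {R : realType} (X : banach_lattice R).
Implicit Types (f g u : R -> R).

Lemma bl_dominated f g : torus_fun f -> X g -> (forall x, `|f x| <= `|g x|) ->
  X f /\ bl_norm X f <= bl_norm X g.
Proof. by move=> tf Xg fg; apply: bl_ideal => //; apply: aeW => x. Qed.

Lemma bl_one : X (fun=> 1).
Proof.
have mT : measurable (torus R : set (lebR R)) by exact: measurable_itv_lebR.
have [+ _] := bl_indic X mT (@subset_refl _ _).
by rewrite periodize_torus indicT.
Qed.

Lemma bl_btorus f : btorus f -> X f.
Proof.
move=> [tf [M fM]]; apply: (bl_dominated tf (bl_scale M bl_one) _).1 => x.
by rewrite mulr1 (le_trans (fM x))// ler_norm.
Qed.

Lemma bl_norm_mono f g : btorus f -> X g -> (forall x, `|f x| <= g x) ->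
  bl_norm X f <= bl_norm X g.
Proof.
move=> [tf _] Xg fg; apply: (bl_dominated tf Xg _).2 => x.
by rewrite (le_trans (fg x))// ler_norm.
Qed.

Lemma bl_sub f g : X f -> X g -> X (fun x => f x - g x).
Proof.
move=> Xf Xg; have := bl_add Xf (bl_scale (-1) Xg).
by under eq_fun do rewrite mulN1r.
Qed.

Lemma bl_normB f g : X f -> X g ->
  bl_norm X (fun x => f x - g x) <= bl_norm X f + bl_norm X g.
Proof.
move=> Xf Xg; have := bl_normD Xf (bl_scale (-1) Xg).
by rewrite bl_normZ// normrN1 mul1r; under eq_fun do rewrite mulN1r.
Qed.

Lemma bl_norm_abs f : btorus f -> bl_norm X (fun x => `|f x|) <= bl_norm X f.
Proof.
move=> bf; apply: (bl_dominated (btorus_norm bf).1 (bl_btorus bf) _).2 => x.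
by rewrite normr_id.
Qed.

Lemma btorus_steklov h f : assumptionA X -> 0 < h -> btorus f ->
  btorus (steklov h f).
Proof.
move=> [XA _] h0 bf; split; first exact/bl_torus/XA/h0/bl_btorus.
have [_ [M fM]] := bf; exists M => t.
exact: steklov_bound h0 (btorus_bmeasurable bf) fM.
Qed.

(** [assumptionA] bounds the means on the unit ball only.  As [bl_norm X f] may
    be [0], one scales by [bl_norm X f + e / D] and lets [e] tend to [0]. *)
Lemma steklov_norm_bound : assumptionA X -> exists2 C : R, 0 < C &
  forall h f, 0 < h -> btorus f -> bl_norm X (steklov h f) <= C * bl_norm X f.
Proof.
move=> [XA [C hC]]; exists (Num.max 1 C); first by rewrite lt_max ltr01.
set D := Num.max 1 C => h f h0 bf; have Xf := bl_btorus bf.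
have N0 := bl_norm_ge0 Xf; have D0 : 0 < D by rewrite lt_max ltr01.
apply/ler_addgt0Pr => e e0.
have d0 : 0 < bl_norm X f + e / D by rewrite ltr_wpDl// divr_gt0.
have Xcf := bl_scale (bl_norm X f + e / D)^-1 Xf.
have := hC _ h Xcf h0.
rewrite bl_normZ// gtr0_norm ?invr_gt0// ler_pdivrMl// mulr1 lerDl.
move=> /(_ (ltW (divr_gt0 e0 D0))).
have -> : steklov h (fun x => (bl_norm X f + e / D)^-1 * f x) =
    (fun x => (bl_norm X f + e / D)^-1 * steklov h f x).
  by apply/funext => x; rewrite (steklovZ _ _ _ (btorus_bmeasurable bf)).
rewrite bl_normZ; last exact: XA.
rewrite gtr0_norm ?invr_gt0// ler_pdivrMl// => /le_trans; apply.
apply: (@le_trans _ _ ((bl_norm X f + e / D) * D)).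
  by rewrite ler_wpM2l ?(ltW d0)// /D le_max lexx orbT.
by rewrite mulrDl mulrC divfK ?gt_eqF.
Qed.

Lemma btorus_steklov_diff r h f : assumptionA X -> 0 < h -> btorus f ->
  btorus (steklov_diff r h f).
Proof.
move=> hA h0 bf; elim: r => [//|r IH]; rewrite /steklov_diff iterS.
exact: btorusB IH (btorus_steklov hA h0 IH).
Qed.

Lemma steklov_diffB r h f g : assumptionA X -> 0 < h -> btorus f -> btorus g ->
  forall x, steklov_diff r h (fun t => f t - g t) x =
    steklov_diff r h f x - steklov_diff r h g x.
Proof.
move=> hA h0 bf bg; elim: r => [//|r IH x].
have bu := btorus_steklov_diff r hA h0 bf.
have bw := btorus_steklov_diff r hA h0 bg.
rewrite /steklov_diff !iterS -!/(steklov_diff r h _).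
rewrite (funext IH).
rewrite (steklovB _ _ (btorus_bmeasurable bu) (btorus_bmeasurable bw)).
by rewrite !opprD !opprK addrACA.
Qed.

(** The terms of the expansion of [(I - A)^r] other than [I] share a factor [A].
    Isolating it shows the regularized part of the difference, which is the one
    controlled in the discrete norm. *)
Lemma steklov_diff_decomp (hA : assumptionA X) r : exists2 C : R, 0 < C &
  forall h g, 0 < h -> btorus g -> exists v, [/\ btorus v,
    bl_norm X v <= C * bl_norm X g &
    forall x, steklov_diff r h g x = g x + steklov h v x].
Proof.
have [C C0 hC] := steklov_norm_bound hA.
elim: r => [|r [D D0 IH]].
  exists 1 => // h g h0 bg; exists (fun=> 0); split.
  - exact: btorus_cst.
  - rewrite mul1r; apply: (bl_dominated (btorus_cst 0).1 (bl_btorus bg) _).2.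
    by move=> y; rewrite normr0.
  - by move=> x; rewrite steklov_cst// addr0.
(* With u = g + A v, one has u - A u = g + A (v - u). *)
exists (D + (1 + C * D)) => [|h g h0 bg].
  by rewrite !addr_gt0// mulr_gt0.
have [v [bv vg vE]] := IH h g h0 bg.
have uE : steklov_diff r h g = (fun x => g x + steklov h v x) by exact/funext.
have bAv := btorus_steklov hA h0 bv.
have bu := btorusD bg bAv.
exists (fun x => v x - (g x + steklov h v x)); split.
- exact: btorusB.
- apply: le_trans (bl_normB (bl_btorus bv) (bl_btorus bu)) _.
  rewrite mulrDl lerD// (le_trans (bl_normD (bl_btorus bg) (bl_btorus bAv)))//.
  rewrite mulrDl mul1r lerD2l -mulrA (le_trans (hC _ _ h0 bv))//.
  by rewrite ler_wpM2l// ltW.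
- move=> x; rewrite /steklov_diff iterS -/(steklov_diff r h g) uE.
  have /= -> := steklovB h x (btorus_bmeasurable bv) (btorus_bmeasurable bu).
  by rewrite addrA.
Qed.

Section DiscreteNorm.
Variables (m : nat) (x : nat -> R).

Lemma discrete_normE f :
  discrete_norm X m x f = bl_norm X (cell_step m x (fun k => `|f (x k)|)).
Proof. by []. Qed.

Lemma discrete_norm_ge0 f : 0 <= discrete_norm X m x f.
Proof.
exact: (bl_norm_ge0 (bl_btorus (btorus_cell_step m x (fun k => `|f (x k)|)))).
Qed.

Lemma cell_step_norm (c : nat -> R) t : (forall k, 0 <= c k) ->
  `|cell_step m x c t| = cell_step m x c t.
Proof.
by move=> c0; rewrite ger0_norm// sumr_ge0// => k _; rewrite mulr_ge0.
Qed.

(** The hypothesis only looks at the nodes; this form covers the triangle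
    inequality for sums and differences at once. *)
Lemma discrete_norm_leD u f g :
  (forall k, (k < m)%N -> `|u (x k)| <= `|f (x k)| + `|g (x k)|) ->
  discrete_norm X m x u <= discrete_norm X m x f + discrete_norm X m x g.
Proof.
move=> ufg; rewrite !discrete_normE.
have Xs (h : R -> R) : X (cell_step m x (fun k => `|h (x k)|)).
  exact: bl_btorus (btorus_cell_step m x _).
apply: (le_trans _ (bl_normD (Xs f) (Xs g))).
apply: bl_norm_mono (btorus_cell_step _ _ _) (bl_add (Xs f) (Xs g)) _ => t.
rewrite cell_step_norm// /cell_step -big_split/=; apply: ler_sum => k _.
by rewrite -mulrDl ler_wpM2r// ufg.
Qed.

Variables (gamma gamma' : R) (n : nat).
Hypotheses (gamma0 : 0 < gamma) (gamma'0 : 0 < gamma') (n0 : (0 < n)%N)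
  (nodes : nodes_ok gamma gamma' n m x).

Lemma discrete_norm_sup u (M : R) : 0 <= M ->
  (forall k, (k < m)%N -> `|u (x k)| <= M) ->
  discrete_norm X m x u <= M * bl_norm X (fun=> 1).
Proof.
move=> M0 uM; rewrite discrete_normE -[M in M * _]ger0_norm//.
rewrite -bl_normZ; last exact: bl_one.
apply: bl_norm_mono (btorus_cell_step _ _ _) (bl_scale _ bl_one) _ => t.
rewrite cell_step_norm// mulr1.
apply: (cell_step_le gamma0 nodes) => // k _ km _.
exact: uM.
Qed.

(** A point [t] of the cell of [x_k] is at distance at most [gamma' / n] from
    [x_k], so the window of length [gamma / n] around [x_k] lies in the one of
    length [(2 gamma' + gamma) / n] around [t].  The ratio of these lengths does
    not depend on [n]. *)
Lemma discrete_norm_avg (hA : assumptionA X) (C : R) u g :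
  (forall h f, 0 < h -> btorus f ->
     bl_norm X (steklov h f) <= C * bl_norm X f) -> 0 < C ->
  btorus g ->
  (forall k, (k < m)%N ->
     `|u (x k)| <= steklov (gamma / n%:R) (fun t => `|g t|) (x k)) ->
  discrete_norm X m x u <=
    (2 * gamma' + gamma) / gamma * C * bl_norm X g.
Proof.
move=> hC C0 bg ug; set c := _ / gamma.
have nR : 0 < n%:R :> R by rewrite ltr0n.
set h := gamma / n%:R in ug; pose H := (2 * gamma' + gamma) / n%:R.
have h0 : 0 < h by rewrite divr_gt0.
have H0 : 0 < H by rewrite divr_gt0// addr_gt0// mulr_gt0.
have HE : H = 2 * (gamma' / n%:R) + h by rewrite /H /h mulrDl mulrA.
have cE : c = H / h.
  by rewrite /c /H /h invf_div mulrA divfK// gt_eqF.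
have c0 : 0 < c by rewrite cE divr_gt0.
have bag := btorus_norm bg.
have bS := btorus_steklov hA H0 bag.
apply: (@le_trans _ _ (bl_norm X (fun t => c * steklov H (fun t => `|g t|) t))).
  rewrite discrete_normE.
  apply: bl_norm_mono (btorus_cell_step _ _ _)
    (bl_btorus (btorusZ c bS)) _ => t.
  have S0 s : 0 <= steklov H (fun t => `|g t|) s.
    rewrite -(steklov_cst 0 s H0); apply: (steklov_le H0).
    - exact: bmeasurable_cst.
    - exact: btorus_bmeasurable.
    - by move=> y _.
  rewrite cell_step_norm//; apply: (cell_step_le gamma0 nodes).
    by rewrite mulr_ge0// ltW.
  move=> k j km /andP[xt tx]; apply: le_trans (ug k km) _.
  (* Move t into the cell; the mean, as an element of X, is periodic. *)
  rewrite -(periodic_int bS.1.1 j t) cE.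
  have [_ _ /(_ k km)/andP[_ gap]] := nodes.
  apply: (steklov_widen h0 _ _ (btorus_bmeasurable bag)).
  - by rewrite HE; lra.
  - by rewrite HE; lra.
  - by move=> y; exact: normr_ge0.
rewrite bl_normZ; last exact: bl_btorus.
rewrite gtr0_norm// -mulrA ler_pM2l//.
apply: le_trans (hC _ _ H0 bag) _.
by rewrite ler_pM2l// bl_norm_abs.
Qed.

End DiscreteNorm.
End Lattice.

(** * Trigonometric polynomials *)

Section TrigPoly.
Context {R : realType}.
Implicit Types (T S : R -> R) (n : nat).

Lemma trig_poly_leq n N T : (N <= n)%N -> trig_poly N T -> trig_poly n T.
Proof.
move=> Nn [a [b TE]].
exists (fun k => if (k < N.+1)%N then a k else 0).
exists (fun k => if (k < N.+1)%N then b k else 0) => x.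
rewrite TE (big_ord_widen n.+1 (fun k =>
  a k * cos (k%:R * x) + b k * sin (k%:R * x)))// big_mkcond/=.
by apply: eq_bigr => k _; case: ifP => // _; rewrite !mul0r addr0.
Qed.

Lemma trig_polyB n S T :
  trig_poly n S -> trig_poly n T -> trig_poly n (fun x => S x - T x).
Proof.
move=> [a [b SE]] [c [d TE]].
exists (fun k => a k - c k), (fun k => b k - d k) => x.
rewrite SE TE -sumrB; apply: eq_bigr => k _.
by rewrite !mulrBl opprD addrACA.
Qed.

Lemma is_derive_trig_sum n (a b : nat -> R) (x : R) :
  is_derive x 1 (fun t : R =>
      \sum_(k < n) (a k * cos (k%:R * t) + b k * sin (k%:R * t)))
    (\sum_(k < n) ((b k * k%:R) * cos (k%:R * x) +
                   (- (a k * k%:R)) * sin (k%:R * x))).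
Proof.
elim: n => [|n IH].
  by under eq_fun do rewrite big_ord0; rewrite big_ord0; exact: is_derive_cst.
under eq_fun do rewrite big_ord_recr/=; rewrite big_ord_recr/=.
have dk : is_derive x 1 (fun t : R => n%:R * t) n%:R.
  by apply: is_derive_eq; rewrite scaler1.
have dcos : is_derive x 1 (fun t : R => cos (n%:R * t))
    (- sin (n%:R * x) * n%:R).
  exact: (@is_derive1_comp _ cos (fun t => n%:R * t)).
have dsin : is_derive x 1 (fun t : R => sin (n%:R * t))
    (cos (n%:R * x) * n%:R).
  exact: (@is_derive1_comp _ sin (fun t => n%:R * t)).
apply: is_deriveD; apply: is_derive_eq; rewrite /GRing.scale/=; lra.
Qed.

Lemma trig_poly_derive n T : trig_poly n T ->
  (forall x, derivable T x 1) /\ trig_poly n (derive1 T).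
Proof.
move=> [a [b TE]].
have {TE}-> : T = (fun t => \sum_(k < n.+1)
    (a k * cos (k%:R * t) + b k * sin (k%:R * t))) by exact/funext.
split=> [x|]; first by have [] := is_derive_trig_sum n.+1 a b x.
exists (fun k => b k * k%:R), (fun k => - (a k * k%:R)) => x.
by rewrite derive1E
  (@derive_val _ _ _ _ _ _ _ (is_derive_trig_sum n.+1 a b x)).
Qed.

Lemma trig_poly_continuous n T : trig_poly n T -> continuous T.
Proof.
move=> /trig_poly_derive[dT _] x.
by apply: differentiable_continuous; exact/derivable1_diffP.
Qed.

Lemma trig_poly_btorus n T : trig_poly n T -> btorus T.
Proof.
move=> nT; split; last first.
  have [a [b TE]] := nT.
  exists (\sum_(k < n.+1) (`|a k| + `|b k|)) => x.
  rewrite TE (le_trans (ler_norm_sum _ _ _))//; apply: ler_sum => k _.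
  rewrite (le_trans (ler_normD _ _))// !normrM.
  by rewrite lerD// ler_piMr// ler_norml ?cos_geN1 ?cos_le1 ?sin_geN1 ?sin_le1.
split; last exact/continuous_lebR/trig_poly_continuous/nT.
move=> x; have [a [b TE]] := nT; rewrite !TE; apply: eq_bigr => k _.
have -> : k%:R * (x + 2 * pi) = k%:R * x + (pi *+ 2) *+ k :> R.
  by rewrite !mulr_natl mulrnDl.
by rewrite (periodicn (@cosD2pi R)) (periodicn (@sinD2pi R)).
Qed.

End TrigPoly.

(** * Null sequences *)

Section Limits.
Context {R : realType}.
Implicit Types (u v t : nat -> R).

Lemma cvg0D u v : u n @[n --> \oo] --> 0 -> v n @[n --> \oo] --> 0 ->
  u n + v n @[n --> \oo] --> 0.
Proof. by move=> u0 v0; rewrite -[0](addr0 0); exact: cvgD. Qed.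

Lemma cvg0Z (c : R) u : u n @[n --> \oo] --> 0 -> c * u n @[n --> \oo] --> 0.
Proof.
by move=> u0; rewrite -[0](mulr0 c); apply: cvgM u0; exact: cvg_cst.
Qed.

Lemma cvg0_div u (c : R) :
  (\forall n \near \oo, 0 <= u n <= c / n%:R) -> u n @[n --> \oo] --> 0.
Proof.
move=> uc; apply: (squeeze_cvgr uc); first exact: cvg_cst.
rewrite -[0 in X in _ --> X](mulr0 c); apply: cvgM; first exact: cvg_cst.
apply/gtr0_cvgV0; last exact: cvgr_idn.
by near=> n; rewrite ltr0n; near: n; exact: nbhs_infty_gt.
Unshelve. all: by end_near. Qed.

(** The sequence [t] may depend on [e], as it does for a quantity attached to a
    polynomial chosen after [e]. *)
Lemma cvg0_approx u v (C : R) : 0 <= C ->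
  (\forall n \near \oo, 0 <= u n) -> v n @[n --> \oo] --> 0 ->
  (forall e, 0 < e -> exists2 t, t n @[n --> \oo] --> 0 &
     \forall n \near \oo, u n <= C * (v n + e) + t n) ->
  u n @[n --> \oo] --> 0.
Proof.
move=> C0 u0 v0 H; apply/cvgr0Pnorm_le => e e0.
pose d := e / (4 * (C + 1)).
have C1 : 0 < 4 * (C + 1) by lra.
have d0 : 0 < d by rewrite divr_gt0.
have dE : C * (d + d) <= e / 2.
  have : d * (4 * (C + 1)) = e by rewrite divfK// gt_eqF.
  by nra.
have [t t0 ut] := H d d0.
near=> n.
have un : 0 <= u n by near: n.
rewrite ger0_norm//.
have : u n <= C * (v n + d) + t n by near: n.
have vn : `|v n| <= d by near: n; exact: cvgr0_norm_le.
have tn : `|t n| <= e / 2 by near: n; apply: cvgr0_norm_le => //; lra.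
have : C * (v n + d) <= C * (d + d).
  by rewrite ler_wpM2l// lerD2r (le_trans (ler_norm _)).
move: (le_trans (ler_norm _) tn); lra.
Unshelve. all: by end_near. Qed.

End Limits.

(** * Steklov differences in the discrete norm *)

Section Sampling.
Context {R : realType} (X : banach_lattice R) (hA : assumptionA X).
Variables (gamma gamma' : R) (m : nat -> nat) (x : nat -> nat -> R).
Hypotheses (gamma0 : 0 < gamma) (gamma'0 : 0 < gamma').
Hypothesis nodes : forall n, (0 < n)%N -> nodes_ok gamma gamma' n (m n) (x n).
Implicit Types (f g T P : R -> R) (n N r : nat).

Let dn n := discrete_norm X (m n) (x n).
Let h n : R := gamma / n%:R.

Let h_gt0 n : (0 < n)%N -> 0 < h n.
Proof. by move=> n0; rewrite divr_gt0// ltr0n. Qed.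

Lemma discrete_norm_steklov : exists2 C : R, 0 < C &
  forall n u g, (0 < n)%N -> btorus g ->
    (forall k, (k < m n)%N ->
       `|u (x n k)| <= steklov (h n) (fun t => `|g t|) (x n k)) ->
    dn n u <= C * bl_norm X g.
Proof.
have [C C0 hC] := steklov_norm_bound hA.
exists ((2 * gamma' + gamma) / gamma * C).
  by rewrite mulr_gt0// divr_gt0// addr_gt0// mulr_gt0.
move=> n u g n0 bg ug.
exact: (discrete_norm_avg gamma0 gamma'0 n0 (nodes n0) hA hC C0 bg ug).
Qed.

Lemma discrete_norm_steklov_diff r : exists2 C : R, 0 < C &
  forall n g, (0 < n)%N -> btorus g ->
    dn n (steklov_diff r (h n) g) <= dn n g + C * bl_norm X g /\
    dn n g <= dn n (steklov_diff r (h n) g) + C * bl_norm X g.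
Proof.
have [C C0 avg] := discrete_norm_steklov.
have [D D0 diffE] := steklov_diff_decomp hA r.
exists (C * D) => [|n g n0 bg]; first exact: mulr_gt0.
have [v [bv vg vE]] := diffE _ g (h_gt0 n0) bg.
have Av : dn n (steklov (h n) v) <= C * D * bl_norm X g.
  rewrite -mulrA; apply: (@le_trans _ _ (C * bl_norm X v)).
    apply: (avg n _ v n0 bv) => k _.
    exact: steklov_norm (h_gt0 n0) (btorus_bmeasurable bv).
  by rewrite ler_pM2l.
split.
- apply: (@le_trans _ _ (dn n g + dn n (steklov (h n) v))).
    by apply: discrete_norm_leD => k _; rewrite vE ler_normD.
  by rewrite lerD2l.
- apply: (@le_trans _ _
    (dn n (steklov_diff r (h n) g) + dn n (steklov (h n) v))).
    apply: discrete_norm_leD => k _; rewrite vE.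
    by rewrite -{1}[g _](addrK (steklov (h n) v (x n k))) ler_normB.
  by rewrite lerD2l.
Qed.

(** The first difference is [O(d)] since the derivative is bounded; each further
    one at most doubles the supremum. *)
Lemma trig_poly_steklov_diff N T r : trig_poly N T -> exists2 M : R, 0 < M &
  forall (d y : R), 0 < d -> `|steklov_diff r.+1 d T y| <= M * d.
Proof.
move=> TT; have bT := trig_poly_btorus TT.
have [dT T'T] := trig_poly_derive TT; have bT' := trig_poly_btorus T'T.
have cT' := trig_poly_continuous T'T.
have [_ [M T'M]] := bT'.
have M0 : 0 <= M := le_trans (normr_ge0 _) (T'M 0).
elim: r => [|r [K K0 IH]].
  exists (M + 1); first by rewrite ltr_wpDl.
  move=> d y d0; rewrite /steklov_diff /=.
  apply: le_trans (steklov_derive1_le y d0 (btorus_bmeasurable bT) dT cT'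
    (btorus_bmeasurable bT')) _.
  rewrite mulrC ler_pM2r//; apply: le_trans (ler_norm _) _.
  apply: le_trans
    (steklov_bound _ d0 (btorus_bmeasurable (btorus_norm bT')) _) _.
  - by move=> t; rewrite normr_id; exact: T'M.
  - by rewrite lerDl.
exists (K + K); first by rewrite addr_gt0.
move=> d y d0; rewrite /steklov_diff iterS -/(steklov_diff r.+1 d T).
have bu := btorus_steklov_diff r.+1 hA d0 bT.
rewrite (le_trans (ler_normB _ _))// mulrDl lerD ?IH//.
exact: (steklov_bound y d0 (btorus_bmeasurable bu) (fun t => IH d t d0)).
Qed.

Lemma trig_poly_discrete_diff_cvg N T r : trig_poly N T -> (0 < r)%N ->
  dn n (steklov_diff r (h n) T) @[n --> \oo] --> 0.
Proof.
move=> TT; case: r => // r _.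
have [M M0 hM] := trig_poly_steklov_diff r TT.
apply: (@cvg0_div _ _ (M * gamma * bl_norm X (fun=> 1))).
near=> n.
have n0 : (0 < n)%N by near: n; exact: nbhs_infty_gt.
apply/andP; split; first exact: discrete_norm_ge0.
rewrite mulrAC -[M * gamma / _]mulrA.
apply: (discrete_norm_sup X gamma0 (nodes n0)).
  by rewrite mulr_ge0// ltW// h_gt0.
by move=> k _; apply: hM; exact: h_gt0.
Unshelve. all: by end_near. Qed.

(** The seminorm of [(I - A)^r f] and that of [f - T] agree up to a term that
    vanishes for fixed [T] and a multiple of the norm of [f - T]. *)
Lemma discrete_norm_transfer r : exists2 C : R, 0 < C &
  forall n f T, (0 < n)%N -> btorus f -> btorus T ->
    dn n (steklov_diff r (h n) f) <= dn n (fun t => f t - T t) +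
      (dn n (steklov_diff r (h n) T) + C * bl_norm X (fun t => f t - T t)) /\
    dn n (fun t => f t - T t) <= dn n (steklov_diff r (h n) f) +
      (dn n (steklov_diff r (h n) T) + C * bl_norm X (fun t => f t - T t)).
Proof.
have [C C0 hC] := discrete_norm_steklov_diff r.
exists C => // n f T n0 bf bT.
have [le1 le2] := hC n _ n0 (btorusB bf bT).
have gE := steklov_diffB r hA (h_gt0 n0) bf bT.
have tri1 : dn n (steklov_diff r (h n) f) <=
    dn n (steklov_diff r (h n) (fun t => f t - T t)) +
    dn n (steklov_diff r (h n) T).
  apply: discrete_norm_leD => k _; rewrite gE.
  by rewrite -{1}[steklov_diff r (h n) f _](subrK
    (steklov_diff r (h n) T (x n k))) ler_normD.
have tri2 : dn n (steklov_diff r (h n) (fun t => f t - T t)) <=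
    dn n (steklov_diff r (h n) f) + dn n (steklov_diff r (h n) T).
  by apply: discrete_norm_leD => k _; rewrite gE ler_normB.
by split; lra.
Qed.

(** * The Bernstein inequality and the discrete norm *)

Variables (Phi : nat -> set (R -> R)) (hPhi : approx_spaces X Phi).

(** For splines, [0 < s0] puts the first derivative among the admitted orders. *)
Lemma approx_spaces_bernstein1 : exists2 B : R, 0 < B &
  forall n P, Phi n P -> bl_norm X (derive1 P) <= B * n%:R * bl_norm X P.
Proof.
have [_ _ _ _ [[_ [B B0 hB]]|[_ [s0 s00 [_ [B B0 hB]]]]]] := hPhi.
  by exists B => // n P PhiP; have [] := hB n 1%N P PhiP I.
by exists B => // n P PhiP; have [] := hB n 1%N P PhiP s00.
Qed.

(** A Marcinkiewicz-type inequality.  The factor [h = gamma / n] of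
    [steklov_derive1_le] cancels the factor [n] of the Bernstein inequality, and
    [P] is the sum of [P - A P] and of a Steklov mean. *)
Lemma approx_spaces_discrete_norm : exists2 C : R, 0 < C &
  forall n N P, (0 < n)%N -> Phi n P -> trig_poly N P ->
    dn n (steklov_diff 1 (h n) P) <= C * bl_norm X P /\
    dn n P <= C * bl_norm X P.
Proof.
have [C C0 avg] := discrete_norm_steklov.
have [D D0 diff] := discrete_norm_steklov_diff 1.
have [B B0 hB] := approx_spaces_bernstein1.
exists (C * (gamma * B) + D) => [|n N P n0 PhiP PT].
  by rewrite addr_gt0// !mulr_gt0.
have bP := trig_poly_btorus PT; have [dP P'T] := trig_poly_derive PT.
have bP' := trig_poly_btorus P'T.
have hn0 := ltW (h_gt0 n0).
have N0 : 0 <= bl_norm X P by exact/bl_norm_ge0/bl_btorus.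
have dPn : dn n (steklov_diff 1 (h n) P) <= C * (gamma * B) * bl_norm X P.
  apply: (@le_trans _ _ (C * bl_norm X (fun t => h n * derive1 P t))).
    apply: (avg n _ _ n0 (btorusZ (h n) bP')) => k _.
    apply: le_trans (steklov_derive1_le (x n k) (h_gt0 n0)
      (btorus_bmeasurable bP) dP (trig_poly_continuous P'T)
      (btorus_bmeasurable bP')) _.
    rewrite -steklovZ; last exact: (btorus_bmeasurable (btorus_norm bP')).
    rewrite le_eqVlt; apply/orP; left; apply/eqP; congr (steklov _ _ _).
    by apply/funext => t; rewrite normrM (ger0_norm hn0).
  rewrite bl_normZ; last exact: bl_btorus.
  rewrite (ger0_norm hn0) -mulrA ler_pM2l//.
  apply: le_trans (ler_wpM2l hn0 (hB n P PhiP)) _.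
  by rewrite (mulrC B) !mulrA /h divfK// pnatr_eq0 -lt0n.
split; first by apply: (le_trans dPn); rewrite ler_wpM2r// lerDl ltW.
have [_ le2] := diff n P n0 bP.
by rewrite (le_trans le2)// mulrDl lerD2r.
Qed.

(** Since [T] need not lie in [Phi n], the previous inequality does not apply to
    [T - Q n].  Fix [k] with [T - Q k] small in norm and split [T - Q n] into
    [T - Q k] and [Q n - Q k]: the second part lies in [Phi n], and the first is
    a fixed polynomial, whose Steklov difference tends to [0] uniformly. *)
Lemma trig_approx_discrete_cvg (Q : nat -> R -> R) N T :
  (forall n, (0 < n)%N -> Phi n (Q n)) ->
  (forall n, (0 < n)%N -> trig_poly n (Q n)) -> trig_poly N T ->
  bl_norm X (fun t => T t - Q n t) @[n --> \oo] --> 0 ->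
  dn n (fun t => T t - Q n t) @[n --> \oo] --> 0.
Proof.
move=> PhiQ trigQ TT TQ0.
have [D D0 diff] := discrete_norm_steklov_diff 1.
have [C C0 hC] := approx_spaces_discrete_norm.
have bT := trig_poly_btorus TT.
have bQ n (n0 : (0 < n)%N) := trig_poly_btorus (trigQ n n0).
apply: (@cvg0_approx _ _ (fun n => bl_norm X (fun t => T t - Q n t)) (C + D)).
- by rewrite addr_ge0// ltW.
- by near=> n; exact: discrete_norm_ge0.
- exact: TQ0.
move=> e e0.
have [k k0 Tk] : exists2 k, (0 < k)%N & bl_norm X (fun t => T t - Q k t) <= e.
  have [k _ kP] : \forall k \near \oo, (0 < k)%N /\
      `|bl_norm X (fun t => T t - Q k t)| <= e.
    near=> k; split; near: k; first exact: nbhs_infty_gt.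
    exact: cvgr0_norm_le.
  have [k0 Tk] := kP k (leqnn k).
  by exists k => //; rewrite (le_trans (ler_norm _)).
pose P1 t := T t - Q k t.
have P1T : trig_poly (maxn N k) P1.
  apply: trig_polyB; first by apply: trig_poly_leq TT; exact: leq_maxl.
  by apply: trig_poly_leq (trigQ k k0); exact: leq_maxr.
have bP1 := trig_poly_btorus P1T.
exists (fun n => dn n (steklov_diff 1 (h n) P1)).
  exact: trig_poly_discrete_diff_cvg P1T _.
near=> n.
have n0 : (0 < n)%N by near: n; exact: nbhs_infty_gt.
have kn : (k <= n)%N by near: n; exact: nbhs_infty_ge.
pose P2 t := Q n t - Q k t.
have P2T : trig_poly n P2.
  exact: trig_polyB (trigQ n n0) (trig_poly_leq kn (trigQ k k0)).
have bP2 := trig_poly_btorus P2T.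
have PhiP2 : Phi n P2.
  have [_ lin mono _ _] := hPhi.
  have := lin n (-1) _ _ (mono _ _ kn _ (PhiQ k k0)) (PhiQ n n0).
  by congr (Phi n _); apply/funext => t; rewrite mulN1r addrC.
have [diffP2 _] := hC n n P2 n0 PhiP2 P2T.
have EP : (fun t => T t - Q n t) = (fun t => P1 t - P2 t).
  by apply/funext => t; rewrite /P1 /P2; lra.
have EP2 : P2 = (fun t => P1 t - (T t - Q n t)).
  by apply/funext => t; rewrite /P1 /P2; lra.
have bP := btorusB bT (bQ n n0).
have [_ leP] := diff n _ n0 bP.
have split_diff : dn n (steklov_diff 1 (h n) (fun t => T t - Q n t)) <=
    dn n (steklov_diff 1 (h n) P1) + dn n (steklov_diff 1 (h n) P2).
  apply: discrete_norm_leD => j _.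
  by rewrite EP (steklov_diffB 1 hA (h_gt0 n0) bP1 bP2) ler_normB.
have normP2 : bl_norm X P2 <= e + bl_norm X (fun t => T t - Q n t).
  rewrite {1}EP2.
  apply: le_trans (bl_normB (bl_btorus X bP1) (bl_btorus X bP)) _.
  by rewrite lerD2r.
have C_P2 := ler_wpM2l (ltW C0) normP2.
have De : 0 <= D * e by rewrite mulr_ge0// ltW.
by move: leP split_diff diffP2 C_P2 De; rewrite /=; lra.
Unshelve. all: by end_near. Qed.

(** * Convergence of the sampling operators *)

Variable G : nat -> (R -> R) -> R -> R.
Hypothesis GPhi : forall n g, (0 < n)%N -> Phi n (G n g).
Hypothesis GB : forall n f g t, G n (fun y => f y - g y) t = G n f t - G n g t.

Let XG n g : (0 < n)%N -> X (G n g).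
Proof. by move=> n0; have [PhiX _ _ _ _] := hPhi; exact: PhiX (GPhi g n0). Qed.

(** Two triangle inequalities for
    [G_n (f - T) = (f - T) + (T - G_n T) - (f - G_n f)]. *)
Lemma sampling_error_le n f T : (0 < n)%N -> X f -> X T ->
  bl_norm X (fun t => f t - G n f t) <=
    bl_norm X (G n (fun t => f t - T t)) +
    (bl_norm X (fun t => f t - T t) + bl_norm X (fun t => T t - G n T t)) /\
  bl_norm X (G n (fun t => f t - T t)) <=
    bl_norm X (fun t => f t - G n f t) +
    (bl_norm X (fun t => f t - T t) + bl_norm X (fun t => T t - G n T t)).
Proof.
move=> n0 Xf XT; set g := fun t => f t - T t.
have Xg : X g by exact: bl_sub.
have XE : X (fun t => T t - G n T t) by apply: bl_sub XT (XG _ n0).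
have Xs := bl_add Xg XE.
have Xe : X (fun t => f t - G n f t) by apply: bl_sub Xf (XG _ n0).
have -> : bl_norm X (G n g) =
    bl_norm X (fun t => g t + (T t - G n T t) - (f t - G n f t)).
  by congr (bl_norm X _); apply/funext => t; rewrite GB /g; lra.
split.
- have -> : (fun t => f t - G n f t) =
      (fun t => g t + (T t - G n T t) -
        (g t + (T t - G n T t) - (f t - G n f t))).
    by apply/funext => t; lra.
  apply: le_trans (bl_normB Xs (bl_sub Xs Xe)) _.
  by rewrite addrC lerD2l bl_normD.
- apply: le_trans (bl_normB Xs Xe) _.
  by rewrite addrC lerD2l bl_normD.
Qed.

Lemma condA3_trig_cvg s N T : (0 < s)%N -> condA3 X s G -> trig_poly N T ->
  bl_norm X (fun t => T t - G n T t) @[n --> \oo] --> 0.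
Proof.
case: s => // s _ [K K0 hK] TT.
have XT := bl_btorus X (trig_poly_btorus TT).
apply: (@cvg0_div _ _ (K * `|bl_norm X (derive1n s.+1 T)|)).
near=> n.
have n0 : (0 < n)%N by near: n; exact: nbhs_infty_gt.
have Nn : (N <= n)%N by near: n; exact: nbhs_infty_ge.
have nR : 0 < n%:R :> R by rewrite ltr0n.
apply/andP; split; first by apply: bl_norm_ge0; exact: bl_sub XT (XG _ n0).
apply: le_trans (hK n T n0 (trig_poly_leq Nn TT)) _.
rewrite -!mulrA ler_pM2l// mulrC.
apply: (@le_trans _ _ (`|bl_norm X (derive1n s.+1 T)| * n%:R ^- s.+1)).
  by rewrite ler_wpM2r ?ler_norm// invr_ge0 exprn_ge0// ltW.
rewrite ler_wpM2l// lef_pV2 ?posrE ?exprn_gt0//.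
by rewrite exprS ler_pMr// exprn_ege1// ler1n.
Unshelve. all: by end_near. Qed.

Variables (r s : nat) (f : R -> R).
Hypotheses (r_gt0 : (0 < r)%N) (s_gt0 : (0 < s)%N).
Hypotheses (bf : btorus f) (hdense : trig_dense X) (hA3 : condA3 X s G).

Let err n t := f t - G n f t.

Let Xf : X f. Proof. exact: bl_btorus. Qed.

Lemma err_cvg_of_diff : condA1 X m x G ->
  dn n (steklov_diff r (h n) f) @[n --> \oo] --> 0 ->
  bl_norm X (err n) @[n --> \oo] --> 0.
Proof.
move=> [K K0 hK] diff0; have [C C0 hC] := discrete_norm_transfer r.
apply: (@cvg0_approx _ _ (fun n => dn n (steklov_diff r (h n) f))
  (1 + K + K * C)).
- by rewrite !addr_ge0 ?mulr_ge0// ltW.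
- near=> n; have n0 : (0 < n)%N by near: n; exact: nbhs_infty_gt.
  by apply: bl_norm_ge0; exact: bl_sub Xf (XG _ n0).
- exact: diff0.
move=> e e0; have [N [T [TT fT]]] := hdense Xf e0.
have bT := trig_poly_btorus TT; have XT := bl_btorus X bT.
exists (fun n => bl_norm X (fun t => T t - G n T t) +
                 K * dn n (steklov_diff r (h n) T)).
  apply: cvg0D; first exact: condA3_trig_cvg s_gt0 hA3 TT.
  by apply: cvg0Z; exact: trig_poly_discrete_diff_cvg TT _.
near=> n; have n0 : (0 < n)%N by near: n; exact: nbhs_infty_gt.
have [+ _] := sampling_error_le n0 Xf XT.
have := hK n (fun t => f t - T t) n0 (bl_sub Xf XT).
have [_ le2] := hC n f T n0 bf bT.
have := ler_wpM2l (ltW K0) le2.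
have := ler_wpM2l (ltW (mulr_gt0 K0 C0)) (ltW fT).
have d0 : 0 <= dn n (steklov_diff r (h n) f) by exact: discrete_norm_ge0.
have := mulr_ge0 (ltW (mulr_gt0 K0 C0)) d0.
have := mulr_gt0 K0 e0.
by rewrite -/(dn n _); lra.
Unshelve. all: by end_near. Qed.

(** [condA2] bounds the discrete norm of [f - T] by the norm of [G_n (f - T)]. *)
Lemma diff_cvg_of_err : condA2 X m x G ->
  bl_norm X (err n) @[n --> \oo] --> 0 ->
  dn n (steklov_diff r (h n) f) @[n --> \oo] --> 0.
Proof.
move=> [K K0 hK] err0; have [C C0 hC] := discrete_norm_transfer r.
have V0 : 0 < K^-1 by rewrite invr_gt0.
apply: (@cvg0_approx _ _ (fun n => bl_norm X (err n)) (K^-1 + C)).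
- by rewrite addr_ge0// ltW.
- by near=> n; exact: discrete_norm_ge0.
- exact: err0.
move=> e e0; have [N [T [TT fT]]] := hdense Xf e0.
have bT := trig_poly_btorus TT; have XT := bl_btorus X bT.
exists (fun n => K^-1 * bl_norm X (fun t => T t - G n T t) +
                 dn n (steklov_diff r (h n) T)).
  apply: cvg0D; last exact: trig_poly_discrete_diff_cvg TT _.
  by apply: cvg0Z; exact: condA3_trig_cvg s_gt0 hA3 TT.
near=> n; have n0 : (0 < n)%N by near: n; exact: nbhs_infty_gt.
have [_ Gg] := sampling_error_le n0 Xf XT.
have := le_trans (hK n (fun t => f t - T t) n0 (bl_sub Xf XT)) Gg.
rewrite -ler_pdivlMl// -/(dn n _) -/(err n).
have [le1 _] := hC n f T n0 bf bT.
have := ler_wpM2l (ltW V0) (ltW fT).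
have := ler_wpM2l (ltW C0) (ltW fT).
have a0 : 0 <= bl_norm X (err n).
  by apply: bl_norm_ge0; exact: bl_sub Xf (XG _ n0).
have := mulr_ge0 (ltW C0) a0.
by lra.
Unshelve. all: by end_near. Qed.

Hypothesis Gtrig : forall n g, (0 < n)%N -> X g -> trig_poly n (G n g).

Let trig_error_cvg N T : trig_poly N T ->
  dn n (fun t => T t - G n T t) @[n --> \oo] --> 0.
Proof.
move=> TT; have XT := bl_btorus X (trig_poly_btorus TT).
apply: (trig_approx_discrete_cvg (N := N) (Q := fun n => G n T)) => //.
- by move=> n n0; exact: GPhi.
- by move=> n n0; exact: Gtrig.
- exact: condA3_trig_cvg s_gt0 hA3 TT.
Qed.

Lemma discrete_err_cvg_of_diff : condA1 X m x G ->
  dn n (steklov_diff r (h n) f) @[n --> \oo] --> 0 ->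
  dn n (err n) @[n --> \oo] --> 0.
Proof.
move=> [K K0 hK] diff0; have [C C0 hC] := discrete_norm_transfer r.
have [D D0 hD] := approx_spaces_discrete_norm.
(* L bounds I - G_n for the discrete norm. *)
pose L := 1 + D * K.
have L0 : 0 < L by rewrite addr_gt0// mulr_gt0.
apply: (@cvg0_approx _ _ (fun n => dn n (steklov_diff r (h n) f)) (L + L * C)).
- by rewrite addr_ge0 ?mulr_ge0// ltW.
- by near=> n; exact: discrete_norm_ge0.
- exact: diff0.
move=> e e0; have [N [T [TT fT]]] := hdense Xf e0.
have bT := trig_poly_btorus TT; have XT := bl_btorus X bT.
exists (fun n => dn n (fun t => T t - G n T t) +
                 L * dn n (steklov_diff r (h n) T)).
  apply: cvg0D; first exact: trig_error_cvg TT.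
  by apply: cvg0Z; exact: trig_poly_discrete_diff_cvg TT _.
near=> n; have n0 : (0 < n)%N by near: n; exact: nbhs_infty_gt.
set g := fun t => f t - T t in fT *.
have Xg : X g by exact: bl_sub.
have [_ le2] := hC n f T n0 bf bT.
have [_ dGg] := hD n n (G n g) n0 (GPhi g n0) (Gtrig n0 Xg).
have err1 : dn n (err n) <=
    dn n (fun t => g t - G n g t) + dn n (fun t => T t - G n T t).
  apply: discrete_norm_leD => k _; rewrite /err.
  have -> : f (x n k) - G n f (x n k) =
    g (x n k) - G n g (x n k) + (T (x n k) - G n T (x n k)).
    by rewrite GB /g; lra.
  exact: ler_normD.
have err2 : dn n (fun t => g t - G n g t) <= dn n g + dn n (G n g).
  by apply: discrete_norm_leD => k _; rewrite ler_normB.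
have DK := ler_wpM2l (ltW D0) (hK n g n0 Xg).
have Lg := ler_wpM2l (ltW L0) le2.
have LC := ler_wpM2l (ltW (mulr_gt0 L0 C0)) (ltW fT).
have d0 : 0 <= dn n (steklov_diff r (h n) f) by exact: discrete_norm_ge0.
have LCd := mulr_ge0 (ltW (mulr_gt0 L0 C0)) d0.
have Le := mulr_gt0 L0 e0.
have gL : dn n g + D * (K * dn n g) = L * dn n g by rewrite /L; lra.
move: err1 err2 dGg DK Lg LC LCd Le gL; rewrite -/(dn n _) -/g; lra.
Unshelve. all: by end_near. Qed.

(** The discrete norm of [f - T] is at most the sum of those of [f - G_n f],
    [G_n (f - T)] and [T - G_n T].  The middle function is in [Phi n], so that its
    norm controls its discrete norm. *)
Lemma diff_cvg_of_discrete_err :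
  bl_norm X (err n) + dn n (err n) @[n --> \oo] --> 0 ->
  dn n (steklov_diff r (h n) f) @[n --> \oo] --> 0.
Proof.
move=> err0; have [C C0 hC] := discrete_norm_transfer r.
have [D D0 hD] := approx_spaces_discrete_norm.
apply: (@cvg0_approx _ _ (fun n => bl_norm X (err n) + dn n (err n))
  (1 + D + C)).
- by rewrite !addr_ge0// ltW.
- by near=> n; exact: discrete_norm_ge0.
- exact: err0.
move=> e e0; have [N [T [TT fT]]] := hdense Xf e0.
have bT := trig_poly_btorus TT; have XT := bl_btorus X bT.
exists (fun n => D * bl_norm X (fun t => T t - G n T t) +
    dn n (fun t => T t - G n T t) + dn n (steklov_diff r (h n) T)).
  apply: cvg0D; last exact: trig_poly_discrete_diff_cvg TT _.
  apply: cvg0D; last exact: trig_error_cvg TT.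
  by apply: cvg0Z; exact: condA3_trig_cvg s_gt0 hA3 TT.
near=> n; have n0 : (0 < n)%N by near: n; exact: nbhs_infty_gt.
set g := fun t => f t - T t in fT *.
have Xg : X g by exact: bl_sub.
have [le1 _] := hC n f T n0 bf bT.
have [_ dGg] := hD n n (G n g) n0 (GPhi g n0) (Gtrig n0 Xg).
have [_ Gg] := sampling_error_le n0 Xf XT.
have g1 : dn n g <= dn n (fun t => err n t + G n g t) +
    dn n (fun t => T t - G n T t).
  apply: discrete_norm_leD => k _.
  have -> : g (x n k) =
      err n (x n k) + G n g (x n k) - (T (x n k) - G n T (x n k)).
    by rewrite /err GB /g; lra.
  exact: ler_normB.
have g2 : dn n (fun t => err n t + G n g t) <= dn n (err n) + dn n (G n g).
  by apply: discrete_norm_leD => k _; rewrite ler_normD.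
have DG := ler_wpM2l (ltW D0) Gg.
have De := ler_wpM2l (ltW D0) (ltW fT).
have Ce := ler_wpM2l (ltW C0) (ltW fT).
have a0 : 0 <= bl_norm X (err n).
  by apply: bl_norm_ge0; exact: bl_sub Xf (XG _ n0).
have w0 : 0 <= dn n (err n) by exact: discrete_norm_ge0.
have Ca := mulr_ge0 (ltW C0) a0; have Cw := mulr_ge0 (ltW C0) w0.
have Dw := mulr_ge0 (ltW D0) w0.
move: le1 dGg g1 g2 DG De Ce a0 w0 Ca Cw Dw; rewrite -/(err n) -/g; lra.
Unshelve. all: by end_near. Qed.

End Sampling.

(** * Linearity of the sampling operators *)

Section SamplingOperators.
Context {R : realType} (X : banach_lattice R).
Variables (Phi : nat -> set (R -> R)) (hPhi : approx_spaces X Phi).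

Lemma sampling_opB m (x : nat -> R) (phi : nat -> R -> R) f g t :
  sampling_op m x phi (fun y => f y - g y) t =
  sampling_op m x phi f t - sampling_op m x phi g t.
Proof.
by rewrite /sampling_op -sumrB; apply: eq_bigr => k _; rewrite mulrBl.
Qed.

Lemma sampling_op_Phi n m (x : nat -> R) (phi : nat -> R -> R) f :
  (forall k, (k < m)%N -> Phi n (phi k)) -> Phi n (sampling_op m x phi f).
Proof.
have [_ lin mono Phi0 _] := hPhi; rewrite /sampling_op.
elim: m => [|m IH] phiP.
  under eq_fun do rewrite big_ord0.
  by apply: (mono 0%N) => //; rewrite Phi0.
under eq_fun do rewrite big_ord_recr/= addrC.
by apply: lin (phiP m _) (IH _) => // k km; apply: phiP; exact: ltnW.
Qed.

End SamplingOperators.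

Theorem corollary3p1 (R : realType) (X : banach_lattice R)
    (hA : assumptionA X) (hdense : trig_dense X)
    (r s : nat) (r_gt0 : (0 < r)%N) (s_gt0 : (0 < s)%N) (hrs : (s <= 2 * r)%N)
    (Phi : nat -> set (R -> R)) (hPhi : approx_spaces X Phi)
    (gamma gamma' : R) (gamma_gt0 : 0 < gamma) (gamma'_gt0 : 0 < gamma')
    (m : nat -> nat) (x : nat -> nat -> R) (phi : nat -> nat -> R -> R)
    (hnodes : forall n, (0 < n)%N -> nodes_ok gamma gamma' n (m n) (x n))
    (hphi : forall n k, (0 < n)%N -> (k < m n)%N -> Phi n (phi n k))
    (f : R -> R) (f_torus : torus_fun f)
    (f_bounded : exists M : R, forall t, `|f t| <= M) :
  let G := fun n => sampling_op (m n) (x n) (phi n) in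
  let dnorm := fun n => discrete_norm X (m n) (x n) in
  let err := fun n t => f t - G n f t in
  (condA1 X m x G -> condA2 X m x G -> condA3 X s G ->
     (bl_norm X (err n) @[n --> \oo] --> (0 : R)) <->
     (dnorm n (steklov_diff r (gamma / n%:R) f) @[n --> \oo] --> (0 : R)))
  /\
  (condA1 X m x G -> condA3 X s G ->
   (forall n g, (0 < n)%N -> X g -> trig_poly n (G n g)) ->
     (bl_norm X (err n) + dnorm n (err n) @[n --> \oo] --> (0 : R)) <->
     (dnorm n (steklov_diff r (gamma / n%:R) f) @[n --> \oo] --> (0 : R))).
Proof.
move=> G dnorm err.
have bf : btorus f by [].
have GPhi n g : (0 < n)%N -> Phi n (G n g).
  by move=> n0; apply: (sampling_op_Phi hPhi) => k; exact: hphi.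
have GB n g1 g2 t : G n (fun y => g1 y - g2 y) t = G n g1 t - G n g2 t.
  exact: sampling_opB.
split=> [A1 A2 A3|A1 A3 Gtrig].
  split.
    exact: (diff_cvg_of_err hA gamma_gt0 gamma'_gt0 hnodes hPhi GPhi GB
      r_gt0 s_gt0 bf hdense A3 A2).
  exact: (err_cvg_of_diff hA gamma_gt0 gamma'_gt0 hnodes hPhi GPhi GB
    r_gt0 s_gt0 bf hdense A3 A1).
split.
  exact: (diff_cvg_of_discrete_err hA gamma_gt0 gamma'_gt0 hnodes hPhi GPhi GB
    r_gt0 s_gt0 bf hdense A3 Gtrig).
move=> diff0; apply: cvg0D.
  exact: (err_cvg_of_diff hA gamma_gt0 gamma'_gt0 hnodes hPhi GPhi GB
    r_gt0 s_gt0 bf hdense A3 A1 diff0).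
exact: (discrete_err_cvg_of_diff hA gamma_gt0 gamma'_gt0 hnodes hPhi GPhi GB
    r_gt0 s_gt0 bf hdense A3 Gtrig A1 diff0).
Qed.
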